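(* Let $H$ be a real Hilbert space, $C\subset H$ a nonempty closed convex set, and let $A,T:H\to H$ be mappings such that: (1) $A$ is monotone and $L$-Lipschitz continuous on $H$ for some $L>0$; (2) $T$ is $\lambda$-demicontractive for some $0\le\lambda<1$, and $I-T$ is demiclosed at zero; (3) $\operatorname{Fix}(T)\cap \mathrm{VI}(C,A)\neq\emptyset$; (4) $\{\theta_k\}_{k\ge1}\subset(0,1)$ satisfies $\lim_{k\to\infty}(1-\theta_k)=0$ and $\sum_{k=1}^\infty(1-\theta_k)=\infty$; $\{\zeta_k\}_{k\ge1}$ is a sequence of positive numbers with $\lim_{k\to\infty}\zeta_k/(1-\theta_k)=0$; and $\{\eta_k\}_{k\ge1}$ is a real sequence such that, for some $a>0$, $\eta_k\in\Big(a,\dfrac{(1-\lambda)\theta_k}{\lambda+\theta_k}\Big)\subset\Big(a,\dfrac{1-\lambda}{1+\lambda}\Big)\subset(a,1-\lambda)$ for all $k$. Let $\delta>0$, $\gamma_1>0$, $\phi\in(0,1)$, let $x^0,x^1\in H$ be arbitrary, and for $k\ge1$ define $$s^k=x^k+\delta_k(x^k-x^{k-1}),\qquad \delta_k=\begin{cases}\min\Big\{\dfrac{\zeta_k}{\|x^k-x^{k-1}\|},\delta\Big\}, & x^k\ne x^{k-1},\\ \delta, & \text{otherwise},\end{cases}$$ $$y^k=P_C(s^k-\gamma_kAs^k),\qquad z^k=y^k-\gamma_k(Ay^k-As^k),$$ $$x^{k+1}=(1-\eta_k)(\theta_kz^k)+\eta_kTz^k,$$ $$\gamma_{k+1}=\begin{cases}\min\Big\{\dfrac{\phi\|s^k-y^k\|}{\|As^k-Ay^k\|},\gamma_k\Big\},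 & As^k-Ay^k\neq0,\\ \gamma_k, & \text{otherwise}.\end{cases}$$ Then the sequence $\{x^k\}$ converges in norm to $u\in\operatorname{Fix}(T)\cap\mathrm{VI}(C,A)$, where $\|u\|=\min\{\|p\|:p\in\operatorname{Fix}(T)\cap\mathrm{VI}(C,A)\}$.
   Context: $\operatorname{Fix}(T)=\{p\in H:Tp=p\}$. $\mathrm{VI}(C,A)=\{p\in C:\langle Ap,x-p\rangle\ge0\ \ \forall x\in C\}$. $P_C$ is the metric projection of $H$ onto $C$. $I$ is the identity on $H$. $A$ is monotone if $\langle Ax-Ay,x-y\rangle\ge0$ for all $x,y\in H$, and $L$-Lipschitz continuous if $\|Ax-Ay\|\le L\|x-y\|$ for all $x,y\in H$. $T$ is $\lambda$-demicontractive ($0\le\lambda<1$) if $\|Tx-z\|^2\le\|x-z\|^2+\lambda\|(I-T)x\|^2$ for all $x\in H$ and all $z\in\operatorname{Fix}(T)$. $I-T$ is demiclosed at zero if, for every sequence $\{v^k\}\subset H$, $v^k\rightharpoonup v$ (weakly) and $(I-T)v^k\to0$ (in norm) imply $v\in\operatorname{Fix}(T)$. Superscripts on vectors are sequence indices.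
   Formalization: The inclusions in the condition on η_k are read as proper, which forces λ > 0; for λ = 0 with ordinary inclusion the claim fails (H = C = ℝ, A = 0, T = I, θ_k = 1−1/(k+1), η_k = 1−2^{-k}, x⁰ = x¹ = 1, tiny ζ_k). *)

(* Defs.v *)
(* MathComp-Analysis. A real Hilbert space is a complete normed module H over
   R : realType together with a dot product (sesquilinear.v, trivial
   conjugation) such that `|x| ^+ 2 = dot x x. *)
From HB Require Import structures.
From mathcomp Require Import all_boot all_order all_algebra.
From mathcomp Require Import all_classical all_reals all_analysis.

Set Implicit Arguments.
Unset Strict Implicit.
Unset Printing Implicit Defensive.

Import Order.TTheory GRing.Theory Num.Theory.
Import numFieldNormedType.Exports.

Local Open Scope classical_set_scope.
Local Open Scope ring_scope.

Definition Fix (H : Type) (T : H -> H) : set H := [set p | T p = p].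

Definition VI (R : realType) (H : normedModType R) (dot : {dot H for idfun})
    (C : set H) (A : H -> H) : set H :=
  [set p | C p /\ forall x, C x -> 0 <= dot (A p) (x - p)].

(* If C is a nonempty closed convex subset of a Hilbert space, the set below is
   a singleton, so the default value x of xget is never used. *)
Definition metric_proj (R : realType) (H : normedModType R) (C : set H)
    (x : H) : H :=
  xget x [set p | C p /\ forall y, C y -> `|x - p| <= `|x - y|].

Definition monotone_op (R : realType) (H : normedModType R)
    (dot : {dot H for idfun}) (A : H -> H) : Prop :=
  forall x y, 0 <= dot (A x - A y) (x - y).

Definition demicontractive (R : realType) (H : normedModType R) (lambda : R)
    (T : H -> H) : Prop :=
  0 <= lambda < 1 /\
  forall x z, Fix T z ->
    `|T x - z| ^+ 2 <= `|x - z| ^+ 2 + lambda * `|x - T x| ^+ 2.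

Definition weak_cvg (R : realType) (H : normedModType R)
    (dot : {dot H for idfun}) (v : nat -> H) (w : H) : Prop :=
  forall h, dot (v k) h @[k --> \oo] --> dot w h.

(* I - T is demiclosed at zero *)
Definition demiclosed_id_sub (R : realType) (H : normedModType R)
    (dot : {dot H for idfun}) (T : H -> H) : Prop :=
  forall (v : nat -> H) (w : H),
    weak_cvg dot v w -> v k - T (v k) @[k --> \oo] --> (0 : H) -> Fix T w.

(* Main.v *)
Require Import Defs.
From HB Require Import structures.
From mathcomp Require Import all_boot all_order all_algebra.
From mathcomp Require Import all_classical all_reals all_analysis.
From mathcomp Require Import ring lra.

Set Implicit Arguments.
Unset Strict Implicit.
Unset Printing Implicit Defensive.

Import Order.TTheory GRing.Theory Num.Theory.
Import numFieldNormedType.Exports.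

Local Open Scope classical_set_scope.
Local Open Scope ring_scope.

(** Demicontractivity makes Fix T an intersection of closed half-spaces, and
    Minty's lemma cuts VI(C, A) out of C by closed half-spaces. Hence the
    solution set is closed and convex, and its point u of least norm satisfies
    <u, u - p> <= 0 for every solution p ([min_norm_point_exists]).

    Put beta_k = (1 - eta_k) (1 - theta_k). The iteration reads
      x_{k+1} - u = [(1 - beta_k) (z_k - u) - eta_k (z_k - T z_k)] - beta_k u,
    a relaxed step followed by a pull of size beta_k towards the origin.
    Tseng's estimate for the forward-backward-forward step ([Tseng_step]) and
    demicontractivity ([demicontractive_step]) give, for all large k,
      |x_{k+1} - u|^2 <= (1 - beta_k) |x_k - u|^2 + beta_k b_k - D_k,
    where D_k is a positive combination of |s_k - y_k|^2 and |z_k - T z_k|^2, and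
    b_k = 2 <u, u - x_{k+1}> + O(zeta_k / (1 - theta_k)). The coefficient of
    |z_k - T z_k|^2 stays away from 0 because lambda > 0, which the properness
    of the interval inclusions enforces.

    Since beta_k -> 0 and the beta_k have infinite sum, such a recursion forces
    |x_k - u| -> 0 as soon as b_k is asymptotically nonpositive along the
    indices where D_k is small ([cvg_to0_of_damped_recursion]): where D_k is
    not small it absorbs the perturbation, and elsewhere the perturbation is
    harmless. That property of b_k is weak compactness: if D_k -> 0 along some
    indices, a weak cluster point w of the z_k is fixed by T because I - T is
    demiclosed, solves the variational inequality by Minty's lemma, and hence
    <u, u - w> <= 0.

    The Hilbert space facts all come from one minimisation result,
    [variational_inequality_exists], which yields the projection onto a closed
    convex set and the Riesz representation; weak sequential compactness
    follows from Riesz by taking limits along an ultrafilter. *)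

(** * Inner product *)

Section InnerProduct.
Variables (R : realType) (H : normedModType R) (dot : {dot H for idfun}).

Lemma dotC x y : dot x y = dot y x.
Proof. by rewrite hermC expr0 mul1r. Qed.

Lemma dotDl x y z : dot (x + y) z = dot x z + dot y z.
Proof. by rewrite linearDl. Qed.

Lemma dotNl x y : dot (- x) y = - dot x y.
Proof. by rewrite linearNl. Qed.

Lemma dotZl t x y : dot (t *: x) y = t * dot x y.
Proof. by rewrite linearZl_LR. Qed.

Lemma dotDr x y z : dot x (y + z) = dot x y + dot x z.
Proof. by rewrite !(dotC x) dotDl. Qed.

Lemma dotNr x y : dot x (- y) = - dot x y.
Proof. by rewrite !(dotC x) dotNl. Qed.

Lemma dotZr t x y : dot x (t *: y) = t * dot x y.
Proof. by rewrite !(dotC x) dotZl. Qed.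

Lemma dot0r x : dot x 0 = 0.
Proof. by rewrite -(scale0r 0) dotZr mul0r. Qed.

Definition dotE := (dotDl, dotDr, dotNl, dotNr, dotZl, dotZr).

Hypothesis dot_norm : forall h : H, `|h| ^+ 2 = dot h h.

Lemma normD2 x y : `|x + y| ^+ 2 = `|x| ^+ 2 + 2 * dot x y + `|y| ^+ 2.
Proof. by rewrite !dot_norm !dotE (dotC y x); ring. Qed.

Lemma normB2 x y : `|x - y| ^+ 2 = `|x| ^+ 2 - 2 * dot x y + `|y| ^+ 2.
Proof. by rewrite normD2 dotNr normrN mulrN. Qed.

Lemma CauchySchwarz x y : `|dot x y| <= `|x| * `|y|.
Proof.
have [->|y0] := eqVneq y 0; first by rewrite dot0r !normr0 mulr0.
have ny : 0 < `|y| by rewrite normr_gt0.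
(* The vector is |y|^2 times the component of x orthogonal to y. *)
have := sqr_ge0 `| (`|y| ^+ 2) *: x - dot x y *: y |.
rewrite dot_norm !dotE (dotC y x) -!dot_norm.
rewrite (_ : _ + _ = `|y| ^+ 2 * ((`|x| * `|y|) ^+ 2 - dot x y ^+ 2)); last by ring.
rewrite pmulr_rge0 ?exprn_gt0// subr_ge0 -[dot x y ^+ 2]real_normK ?num_real//.
by rewrite ler_sqr ?nnegrE// mulr_ge0.
Qed.

Lemma dot_le x y : dot x y <= `|x| * `|y|.
Proof. exact: le_trans (ler_norm _) (CauchySchwarz x y). Qed.

(** Reduces an identity between linear combinations of vectors to a ring
    identity between their inner products with an arbitrary vector. *)
Lemma eq_from_dot u v : (forall h, dot u h = dot v h) -> u = v.
Proof.
move=> uv; apply/eqP; rewrite -subr_eq0 -normr_eq0 -sqrf_eq0 dot_norm.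
by rewrite dotDl dotNl uv subrr.
Qed.

End InnerProduct.

(** * Convex sets, projection and Riesz representation *)

Section Convex.
Variables (R : realType) (H : normedModType R) (dot : {dot H for idfun}).
Hypothesis dot_norm : forall h : H, `|h| ^+ 2 = dot h h.

Lemma convex_set_segmentP (C : set H) :
  convex_set (C : set (convex_lmodType H)) <->
  forall x y t, C x -> C y -> 0 <= t <= 1 -> C (x + t *: (y - x)).
Proof.
have segE (x y : H) (t : R) : x + t *: (y - x) = (1 - t) *: x + t *: y.
  by rewrite scalerBr scalerBl scale1r [t *: y - _]addrC addrA.
split=> [Ccv x y t Cx Cy t01|Ccv x y t /set_mem Cx /set_mem Cy].
  have /set_mem := Ccv y x (Itv01 (andP t01).1 (andP t01).2)
    (mem_set Cy) (mem_set Cx).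
  by rewrite /conv /= segE addrC.
apply/mem_set.
have t01 : 0 <= (t%:inum : R) <= 1 by apply/andP; split.
by have := Ccv y x _ Cy Cx t01; rewrite segE addrC.
Qed.

(** Arbitrary families of half-spaces are the form in which the fixed points
    and the solutions of the variational inequality are described below. *)
Lemma convex_halfspaces (I : Type) (P : set I) (h : I -> H) (c : I -> R) :
  convex_set ([set x | forall i, P i -> dot (h i) x <= c i]
    : set (convex_lmodType H)).
Proof.
apply/convex_set_segmentP => x y t hx hy /andP[t0 t1] i Pi.
rewrite !dotE; move: (hx i Pi) (hy i Pi) => {}hx {}hy.
by nra.
Qed.

Lemma dot_cvgr (T : Type) (F : set_system T) {FF : Filter F} (v : T -> H) w h :
  v @ F --> w -> dot h (v t) @[t --> F] --> dot h w.
Proof.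
move=> vw; apply/cvgrPdist_le => e e0.
have h0 : 0 < `|h| + 1 by rewrite ltr_wpDl.
have /cvgrPdist_le/(_ _ (divr_gt0 e0 h0)) := vw; apply: filterS => t.
rewrite ler_pdivlMr// => ht; rewrite -dotNr -dotDr.
apply: (le_trans (CauchySchwarz dot_norm _ _)).
by apply: le_trans ht; rewrite mulrC ler_wpM2l// lerDl.
Qed.

Lemma closed_halfspaces (I : Type) (P : set I) (h : I -> H) (c : I -> R) :
  closed [set x | forall i, P i -> dot (h i) x <= c i].
Proof.
have -> : [set x | forall i, P i -> dot (h i) x <= c i] =
    \bigcap_(i in P) (dot (h i) @^-1` [set r | r <= c i]).
  by apply/seteqP; split => x /=.
apply: closed_bigI => i Pi; apply: preimage_closed => [x _|].
  exact: dot_cvgr.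
exact: closed_le.
Qed.

(** Letting t tend to 0: the first-order condition drawn from a comparison
    with the points p + t (q - p) of a segment. *)
Lemma ge0_of_small (b c : R) :
  (forall t, 0 < t <= 1 -> 0 <= b + t * c) -> 0 <= b.
Proof.
move=> bc; rewrite leNgt; apply/negP => b0.
have c0 : 0 < `|c| - b by rewrite ltr_wpDl ?normr_ge0 ?oppr_gt0.
have c1 := ler_norm c.
have D : 0 < 2 * (`|c| - b) by rewrite mulr_gt0.
(* The witness t = - b / (2 (|c| - b)) lies in ]0, 1] and t * |c| < - b. *)
have tD : - b / (2 * (`|c| - b)) * (2 * (`|c| - b)) = - b.
  by rewrite divfK// gt_eqF.
have t0 : 0 < - b / (2 * (`|c| - b)) by rewrite divr_gt0 ?oppr_gt0.
have t1 : - b / (2 * (`|c| - b)) <= 1.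
  rewrite ler_pdivrMr// mul1r; have := normr_ge0 c; lra.
have := bc (- b / (2 * (`|c| - b))); rewrite t0 t1 => /(_ isT).
apply/negP; rewrite -ltNge; move: tD t0 {t1}; set t := _ / _ => tD t0.
have tc : t * c <= t * `|c| by rewrite ler_pM2l.
have tb : t * b < 0 by rewrite pmulr_rlt0.
by nra.
Qed.

End Convex.

Section Minimisation.
Variables (R : realType) (H : completeNormedModType R).
Variable dot : {dot H for idfun}.
Hypothesis dot_norm : forall h : H, `|h| ^+ 2 = dot h h.

Lemma cvg_of_dist2_le (v : nat -> H) :
  (forall n k, `|v n - v k| ^+ 2 <= 2 * (n.+1%:R^-1 + k.+1%:R^-1)) ->
  cvgn v.
Proof.
move=> vc; apply/cauchy_cvgP/cauchy_exP => e e0.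
have e2 : 0 < e ^+ 2 / 4 by rewrite divr_gt0 ?exprn_gt0.
have [N _ HN] := near_infty_natSinv_lt (PosNum e2).
have {}HN n : (N <= n)%N -> n.+1%:R^-1 < e ^+ 2 / 4 by exact: HN.
exists (v N); exists N => // n /= Nn.
rewrite -ball_normE /= -ltr_sqr ?nnegrE ?(ltW e0)//.
apply: le_lt_trans (vc _ _) _.
move: (HN _ (leqnn N)) (HN _ Nn).
move: (e ^+ 2) (N.+1%:R^-1) (n.+1%:R^-1) => r a b; lra.
Qed.

(** The point p minimises J(h) = |h|^2 - 2 f(h) over C. By the parallelogram
    law a minimising sequence is Cauchy, since the midpoint of two of its terms
    is again in C; comparing J(p) with J along segments issued from p gives the
    inequality. The case f = <x, .> is the projection of x onto C, and the case
    where C is the whole space is the Riesz representation. *)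
Theorem variational_inequality_exists (C : set H) (f : H -> R) (M : R) :
  C !=set0 -> closed C -> convex_set (C : set (convex_lmodType H)) ->
  scalar f -> (forall h, `|f h| <= M * `|h|) ->
  exists2 p, C p & forall q, C q -> f (q - p) <= dot p (q - p).
Proof.
move=> [c0 Cc0] Ccl /convex_set_segmentP Ccv flin fbd.
have fD x y : f (x + y) = f x + f y by rewrite -[x]scale1r flin mul1r scale1r.
have f0 : f 0 = 0 by apply: (addrI (f 0)); rewrite -fD !addr0.
have fZ t x : f (t *: x) = t * f x by rewrite -[_ *: _]addr0 flin f0 addr0.
have fB x y : f (x - y) = f x - f y by rewrite fD -scaleN1r fZ mulN1r.
pose J h := `|h| ^+ 2 - 2 * f h.
pose m := inf (J @` C).
have Jlb : has_lbound (J @` C).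
  exists (- M ^+ 2) => _ [h _ <-].
  have := fbd h; rewrite /J ler_norml => /andP[_ hf].
  have := sqr_ge0 (`|h| - M); nra.
have mJ h : C h -> m <= J h by move=> Ch; apply: ge_inf => //; exists h.
have /choice[v vP] : forall n : nat, exists h, C h /\ J h < m + n.+1%:R^-1.
  move=> n.
  have n0 : 0 < (n.+1%:R^-1 : R) by rewrite invr_gt0.
  have Jinf : has_inf (J @` C) by split => //; exists (J c0), c0.
  by have [_ [h Ch <-] Jh] := inf_adherent n0 Jinf; exists h.
have vcvg : cvgn v.
  apply: cvg_of_dist2_le => n k.
  have [Cn Jn] := vP n; have [Ck Jk] := vP k.
  have half01 : 0 <= (2^-1 : R) <= 1 by lra.
  have Jm := mJ _ (Ccv _ _ _ Cn Ck half01); move: Jn Jk Jm.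
  rewrite /J !(fB, fD, fZ) !dot_norm !dotE (dotC dot (v k) (v n)).
  move: (n.+1%:R^-1) (k.+1%:R^-1) => r b. lra.
have [p vp] := (cvg_ex (v @ \oo)).1 vcvg.
have Cp : C p.
  by apply: (closed_cvg C Ccl _ _ vp); near=> n; exact: (vP n).1.
have Jp : J p <= m.
  have J_cvg : J (v n) @[n --> \oo] --> J p.
    apply: cvgB.
      by rewrite expr2; under eq_fun do rewrite expr2; apply: cvgM; apply: cvg_norm.
    apply: cvgMl_tmp; apply/cvgrPdist_le => e e0.
    have M0 : 0 < `|M| + 1 by rewrite ltr_wpDl.
    have /cvgrPdist_le/(_ _ (divr_gt0 e0 M0)) := vp; apply: filterS => n.
    rewrite ler_pdivlMr// => hn; rewrite -fB; apply: (le_trans (fbd _)).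
    apply: le_trans hn; rewrite mulrC ler_wpM2l//.
    by have := ler_norm M; lra.
  apply/ler_addgt0Pr => e e0; apply: (cvgr_to_le J_cvg).
  have := near_infty_natSinv_lt (PosNum e0); apply: filterS => n /= ne.
  by apply/ltW/(lt_trans (vP n).2); rewrite ltrD2l.
exists p => // q Cq.
rewrite -subr_ge0.
(* J(p + t (q - p)) - J(p) = t * (2 (<p, q - p> - f(q - p)) + t |q - p|^2). *)
suff : 0 <= 2 * (dot p (q - p) - f (q - p)) by lra.
apply: (@ge0_of_small _ _ (`|q - p| ^+ 2)) => t /andP[t0 t1].
have Cpq : C (p + t *: (q - p)) by apply: Ccv => //; rewrite ltW.
have := le_trans Jp (mJ _ Cpq).
rewrite /J fD fZ (normD2 dot_norm) dotZr normrZ (gtr0_norm t0) => h.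
rewrite -(pmulr_rge0 _ t0); nra.
Unshelve. all: by end_near. Qed.

(** Over the whole space the variational inequality can be tested at both
    h and - h, hence is an equality. *)
Lemma riesz_representation (f : H -> R) (M : R) :
  scalar f -> (forall h, `|f h| <= M * `|h|) ->
  exists w, forall h, f h = dot w h.
Proof.
move=> flin fbd.
have [|||w _ wP] := @variational_inequality_exists setT f M _ _ _ flin fbd.
- by exists 0.
- exact: closedT.
- by apply/convex_set_segmentP.
have f0 : f 0 = 0.
  by have := flin 1 0 0; rewrite scale1r addr0 mul1r; lra.
have le h : f h <= dot w h.
  by have := wP (w + h) I; rewrite [w + h]addrC addrK.
exists w => h; apply/eqP; rewrite eq_le le /=.
have fN : f (- h) = - f h.
  by have := flin (-1) h 0; rewrite scaleN1r addr0 f0; lra.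
by have := le (- h); rewrite dotNr fN; lra.
Qed.

Lemma nearest_point_exists (C : set H) (x : H) :
  C !=set0 -> closed C -> convex_set (C : set (convex_lmodType H)) ->
  exists2 p, C p & forall q, C q -> dot (x - p) (q - p) <= 0.
Proof.
move=> C0 Ccl Ccv.
have [||p Cp pP] := @variational_inequality_exists C (dot x) `|x| C0 Ccl Ccv _ _.
- by move=> t u w; rewrite dotDr dotZr.
- by move=> h; exact: CauchySchwarz.
by exists p => // q Cq; have := pP q Cq; rewrite [dot (x - p) _]dotDl dotNl; lra.
Qed.

(** The obtuse angle criterion. A nearest point satisfies it by comparison
    along segments; conversely a point satisfying it is nearest, so the default
    value in the definition of the projection is never reached. *)
Lemma metric_projP (C : set H) (x : H) :
  C !=set0 -> closed C -> convex_set (C : set (convex_lmodType H)) ->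
  C (metric_proj C x) /\
  forall q, C q -> dot (x - metric_proj C x) (q - metric_proj C x) <= 0.
Proof.
move=> C0 Ccl Ccv; rewrite /metric_proj; case: xgetP => [p _ [Cp pmin]|none].
  split => // q Cq.
  suff : 0 <= - 2 * dot (x - p) (q - p) by lra.
  apply: (@ge0_of_small _ _ (`|q - p| ^+ 2)) => t /andP[t0 t1].
  have Cpq : C (p + t *: (q - p)).
    by apply: (convex_set_segmentP C).1 => //; rewrite ltW.
  have := pmin _ Cpq; rewrite -ler_sqr ?nnegrE// opprD addrA.
  rewrite (normB2 dot_norm (x - p)) dotZr normrZ (gtr0_norm t0) => h.
  by rewrite -(pmulr_rge0 _ t0); nra.
have [p Cp pP] := nearest_point_exists x C0 Ccl Ccv.
case: (none p); split => // q Cq.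
rewrite -ler_sqr ?nnegrE//.
rewrite (_ : x - q = (x - p) - (q - p)); last by rewrite opprB addrA subrK.
by rewrite (normB2 dot_norm (x - p)); have := pP q Cq; have := sqr_ge0 `|q - p|; lra.
Qed.

End Minimisation.

(** * Weak sequential compactness *)

(** For each A, either the preimage of A or its complement belongs to U. *)
Lemma ultra_fmap (T S : Type) (f : T -> S) (U : set_system T) :
  UltraFilter U -> UltraFilter (fmap f U).
Proof.
move=> UU; have UF : ProperFilter U by exact: ultra_proper.
split; first exact: fmap_proper_filter.
move=> G GF UG; apply/seteqP; split => // A GA.
have [//|nA] := in_ultra_setVsetC (f @^-1` A) UU.
have /filter_ex[x []//] : G (A `&` ~` A) by apply: filterI => //; exact: UG.
Qed.

Section WeakCompactness.
Variables (R : realType) (H : completeNormedModType R).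
Variable dot : {dot H for idfun}.
Hypothesis dot_norm : forall h : H, `|h| ^+ 2 = dot h h.

(** Each <v_n, h> ranges over a compact interval, so it converges along the
    ultrafilter; the limit is a bounded linear form of h, represented by w. *)
Lemma ultra_weak_limit (U : set_system nat) (v : nat -> H) (M : R) :
  UltraFilter U -> (forall n, `|v n| <= M) ->
  exists w, forall h, dot (v n) h @[n --> U] --> dot w h.
Proof.
move=> UU vM; have UF : ProperFilter U by exact: ultra_proper.
have bd h n : `|dot (v n) h| <= M * `|h|.
  by apply: le_trans (CauchySchwarz dot_norm _ _) _; rewrite ler_wpM2r.
have lim_ex h : exists l : R, `|l| <= M * `|h| /\ dot (v n) h @[n --> U] --> l.
  have := @segment_compact R (- (M * `|h|)) (M * `|h|).
  rewrite compact_ultra => /(_ (fmap (fun n => dot (v n) h) U) (ultra_fmap _ UU)).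
  case=> [|l [lM ul]].
    by apply: (@filterE _ U) => n; rewrite /= in_itv /= -ler_norml.
  by exists l; split => //; move: lM; rewrite /= in_itv /= -ler_norml.
have [f fP] := choice lim_ex.
have flin : scalar f.
  move=> t x y; apply: (cvg_unique _ (fP (t *: x + y)).2) => //.
  rewrite /=; under eq_fun do rewrite dotDr dotZr.
  by apply: cvgD; [apply: cvgMl_tmp|]; exact: (fP _).2.
have [w fw] := riesz_representation dot_norm flin (fun h => (fP h).1).
by exists w => h; rewrite -fw; exact: (fP h).2.
Qed.

(** The vectors h on which v_(g n) - w vanishes in the limit form a closed
    subspace. It contains w and all the v_m; a vector orthogonal to it is
    orthogonal to every v_(g n) - w, hence belongs to it. So it is everything. *)
Lemma weak_cvg_of_self_tests (v : nat -> H) (w : H) (M : R) (g : nat -> nat) :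
  (forall n, `|v n| <= M) ->
  dot (v (g n) - w) w @[n --> \oo] --> (0 : R) ->
  (forall m, dot (v (g n) - w) (v m) @[n --> \oo] --> (0 : R)) ->
  weak_cvg dot (v \o g) w.
Proof.
move=> vM ww wv.
pose K := [set h | dot (v (g n) - w) h @[n --> \oo] --> (0 : R)].
have Klin x y t : K x -> K y -> K (x + t *: y).
  move=> Kx Ky; rewrite /K /= -[X in _ --> X](addr0 0) -[X in _ --> _ + X](mulr0 t).
  under eq_fun do rewrite dotDr dotZr.
  by apply: cvgD => //; exact: cvgMl_tmp.
have K0 : K 0 by rewrite /K /=; under eq_fun do rewrite dot0r; exact: cvg_cst.
have Kcl : closed K.
  move=> h hK; apply/cvgrPdist_le => e e0.
  have B0 : 0 < M + `|w| + 1.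
    by rewrite ltr_wpDl// addr_ge0// (le_trans _ (vM 0%N)).
  have eB : 0 < e / 2 / (M + `|w| + 1) by rewrite !divr_gt0.
  have [h' [Kh' hh']] := hK _ (nbhsx_ballx h _ eB).
  have e2 : 0 < e / 2 by rewrite divr_gt0.
  have /cvgrPdist_le/(_ _ e2) := Kh'; apply: filterS => n.
  rewrite !sub0r !normrN => dn.
  rewrite -[h](subrK h') dotDr (le_trans (ler_normD _ _))// [leRHS](splitr e).
  apply: lerD => //; apply: (le_trans (CauchySchwarz dot_norm _ _)).
  move: hh'; rewrite -ball_normE /= ltr_pdivlMr// mulrC => /ltW.
  apply: le_trans; rewrite ler_wpM2r//.
  by have := ler_normB (v (g n)) w; have := vM (g n); lra.
have KT h : K h.
  have Kcv : convex_set (K : set (convex_lmodType H)).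
    apply/convex_set_segmentP => x y t Kx Ky _; apply: (Klin) => //.
    by rewrite -scaleN1r; apply: Klin.
  have [p Kp pP] := nearest_point_exists dot_norm h (ex_intro _ 0 K0) Kcl Kcv.
  have ort q : K q -> dot q (h - p) = 0.
    move=> Kq; rewrite dotC.
    have := pP _ (Klin p q 1 Kp Kq); have := pP _ (Klin p q (-1) Kp Kq).
    by rewrite ![p + _]addrC !addrK !dotZr; lra.
  have Khp : K (h - p).
    rewrite /K /=; under eq_fun do rewrite dotDl dotNl (ort _ (wv _)) (ort _ ww) subr0.
    exact: cvg_cst.
  by rewrite -(subrK p h) -[X in K (_ + X)]scale1r; exact: Klin.
move=> h; rewrite -[X in _ --> X]add0r.
under eq_fun do rewrite /= -(subrK w (v _)) dotDl.
by apply: cvgD; [exact: KT|exact: cvg_cst].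
Qed.

(** Convergence along an ultrafilter does not give a subsequence by itself, but
    it gives, for each n, an index g n >= n at which the finitely many tests
    against w, v_0, ..., v_n are small; these tests suffice. *)
Theorem bounded_weakly_cvg_subsequence (v : nat -> H) (M : R) :
  (forall n, `|v n| <= M) ->
  exists g w, (forall n, (n <= g n)%N) /\ weak_cvg dot (v \o g) w.
Proof.
move=> vM; have [U [UU oU]] := ultraFilterLemma eventually_filter.
have UF : ProperFilter U by exact: ultra_proper.
have [w wP] := ultra_weak_limit UU vM.
have near_small h N : \forall n \near U, `|dot (v n - w) h| <= N.+1%:R^-1.
  have N0 : 0 < (N.+1%:R^-1 : R) by rewrite invr_gt0.
  have /cvgrPdist_le/(_ _ N0) := wP h; apply: filterS => n.
  by rewrite distrC dotDl dotNl.
have /choice[g gP] : forall N, exists n, [/\ (N <= n)%N,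
    `|dot (v n - w) w| <= N.+1%:R^-1 &
    forall m : 'I_N.+1, `|dot (v n - w) (v m)| <= N.+1%:R^-1].
  move=> N; apply: (@filter_ex _ U); near=> n; split.
  - by near: n; apply: oU; exact: nbhs_infty_ge.
  - by near: n; exact: near_small.
  - by near: n; apply: filter_forall => m; exact: near_small.
have small (u : nat -> R) m :
    (forall n, (m <= n)%N -> `|u n| <= n.+1%:R^-1) -> u @ \oo --> (0 : R).
  move=> um; apply/norm_cvg0P; apply: (@squeeze_cvgr _ _ _ _ (cst 0) harmonic).
  - by exists m => // n /= /um; rewrite normr_ge0.
  - exact: cvg_cst.
  - exact: cvg_harmonic.
exists g, w; split; first by move=> n; have [] := gP n.
apply: (weak_cvg_of_self_tests vM); first by apply: (small _ 0%N) => n _; have [] := gP n.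
move=> m; apply: (small _ m) => n mn; have [_ _] := gP n.
by move=> /(_ (Ordinal (mn : (m < n.+1)%N))).
Unshelve. all: by end_near. Qed.

(** The half-space through the projection p of w that contains C also contains
    the weak limit w, which forces w = p. *)
Lemma weak_cvg_closed_convex (C : set H) (v : nat -> H) (w : H) :
  closed C -> convex_set (C : set (convex_lmodType H)) ->
  (forall n, C (v n)) -> weak_cvg dot v w -> C w.
Proof.
move=> Ccl Ccv Cv vw.
have C0 : C !=set0 by exists (v 0%N).
have [p Cp pP] := nearest_point_exists dot_norm w C0 Ccl Ccv.
have : dot w (w - p) <= dot p (w - p).
  apply: (cvgr_to_le (vw (w - p))); near=> n.
  by have := pP _ (Cv n); rewrite dotDr dotNr (dotC _ (v n)) (dotC _ p); lra.
rewrite -subr_le0 -dotNl -dotDl -dot_norm => wp.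
have /eqP : `|w - p| ^+ 2 = 0 by apply/eqP; rewrite eq_le wp sqr_ge0.
by rewrite expf_eq0 /= normr_eq0 subr_eq0 => /eqP ->.
Unshelve. all: by end_near. Qed.

End WeakCompactness.

(** * A damped recursion of real numbers *)

Section Recursion.
Variable R : realType.

Lemma nneseries_unbounded (u : nat -> R) :
  (forall k, (1 <= k)%N -> 0 <= u k) ->
  (\sum_(1 <= k <oo) (u k)%:E = +oo)%E ->
  forall N M, (1 <= N)%N -> exists n, M < \sum_(N <= k < n) u k.
Proof.
move=> u0 uoo N M N1; apply: contrapT => no.
have le n : \sum_(N <= k < n) u k <= M.
  by rewrite leNgt; apply/negP => lt; apply: no; exists n.
suff : (\sum_(1 <= k <oo) (u k)%:E <= (\sum_(1 <= k < N) u k + M)%:E)%E.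
  by rewrite uoo.
apply: lime_le; first by apply: is_cvg_nneseries => n n1 _; rewrite lee_fin u0.
exists N => // n /= Nn; rewrite sumEFin lee_fin.
by rewrite (big_cat_nat N1 Nn) /= lerD2l.
Qed.

(** Above the level 2 e, the sequence a decreases by at least beta_k * e at each
    late step: if D_k > d, the damping absorbs the perturbation beta_k * b_k,
    which tends to 0; otherwise b_k <= e. As the beta_k have infinite sum, a
    late index K has a K <= 2 e, and from then on a never exceeds 3 e: a step
    starting below 2 e climbs by at most e, and one starting above goes down. *)
Lemma cvg_to0_of_damped_recursion (a b beta D : nat -> R) (B : R) (N0 : nat) :
  (forall k, (N0 <= k)%N ->
    [/\ 0 <= a k, 0 <= beta k, 0 <= D k, b k <= B &
        a k.+1 <= (1 - beta k) * a k + beta k * b k - D k]) ->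
  beta @ \oo --> (0 : R) ->
  (forall N M, (N0 <= N)%N -> exists n, M < \sum_(N <= k < n) beta k) ->
  (forall e, 0 < e -> exists2 d, 0 < d &
    \forall k \near \oo, D k <= d -> b k <= e) ->
  a @ \oo --> (0 : R).
Proof.
move=> rec beta0 beta_div small; apply/cvgrPdist_le => e' e'0.
have [e e0 ->] : exists2 e, 0 < e & e' = 3 * e.
  by exists (e' / 3); [rewrite divr_gt0|rewrite mulrC divfK].
have {e' e'0} [d d0 [N1 _ small1]] := small e e0.
have [q q0 [qd qe]] : exists2 q, 0 < q & q <= d /\ q <= e.
  by exists (Num.min d e); rewrite ?lt_min ?d0 ?e0// !ge_min !lexx orbT.
have Be0 : 0 < `|B| + e by rewrite ltr_wpDl.
have /cvgrPdist_le/(_ _ (divr_gt0 q0 Be0))[N2 _ betaq] := beta0.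
pose N := maxn N0 (maxn N1 N2).
have step k : (N <= k)%N -> [/\ 0 <= a k, 0 <= beta k,
    2 * e <= a k -> a k.+1 <= a k - beta k * e &
    a k <= 2 * e -> a k.+1 <= 3 * e].
  rewrite !geq_max => /and3P[k0 k1 k2].
  have [a0 bt0 D0 bB reck] := rec k k0.
  have bq : beta k * `|B| + beta k * e <= q.
    by have := betaq k k2; rewrite /= sub0r normrN ger0_norm// ler_pdivlMr// mulrDr.
  have bte : 0 <= beta k * e by rewrite mulr_ge0// ltW.
  have bta : 0 <= beta k * a k by rewrite mulr_ge0.
  have btB : beta k * b k <= beta k * `|B|.
    by rewrite ler_wpM2l// (le_trans bB)// ler_norm.
  split=> // ak; last lra.
  have bt2e : beta k * (2 * e) <= beta k * a k by rewrite ler_wpM2l.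
  have [Dd|dD] := leP (D k) d; last lra.
  have : beta k * b k <= beta k * e by rewrite ler_wpM2l// small1.
  lra.
have [K NK aK] : exists2 K, (N <= K)%N & a K <= 2 * e.
  apply: contrapT => no.
  have big k : (N <= k)%N -> 2 * e <= a k.
    move=> Nk; rewrite leNgt; apply/negP => lt.
    by apply: no; exists k => //; exact: ltW.
  have desc n : (N <= n)%N -> a n <= a N - e * \sum_(N <= k < n) beta k.
    elim: n => [|n IH]; first by rewrite leqn0 => /eqP ->; rewrite big_geq// mulr0 subr0.
    rewrite leq_eqVlt => /orP[/eqP <-|]; first by rewrite big_geq// mulr0 subr0.
    rewrite ltnS => Nn; rewrite big_nat_recr//=.
    have [_ _ /(_ (big n Nn))] := step n Nn.
    by have := IH Nn; lra.
  have [n] := beta_div N (a N / e) (leq_maxl _ _).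
  have [Nn|nN] := leqP N n; last first.
    rewrite big_geq ?(ltnW nN)// ltNge => /negP; apply.
    by rewrite divr_ge0 ?(ltW e0)//; have [] := step N (leqnn N).
  rewrite ltr_pdivrMr// => lt.
  have [a0 _ _ _] := step n Nn.
  by have := desc n Nn; apply/negP; rewrite -ltNge; lra.
exists K => // k /= Kk.
have Nk : (N <= k)%N by exact: leq_trans Kk.
rewrite sub0r normrN ger0_norm; last by have [] := step k Nk.
elim: k Kk Nk => [|k IH]; first by rewrite leqn0 => /eqP K0 _; move: aK; rewrite K0; lra.
rewrite leq_eqVlt => /orP[/eqP <- _|]; first lra.
rewrite ltnS => Kk _.
have Nk := leq_trans NK Kk.
have {}IH := IH Kk Nk; have [a0 bt0 hi lo] := step k Nk.
have bte : 0 <= beta k * e by rewrite mulr_ge0// ltW.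
by have [/lo//|/ltW/hi] := leP (a k) (2 * e); lra.
Qed.

End Recursion.

(** * The solution set and the one-step estimates *)

Section SolutionSet.
Variables (R : realType) (H : completeNormedModType R).
Variable dot : {dot H for idfun}.
Hypothesis dot_norm : forall h : H, `|h| ^+ 2 = dot h h.

Lemma lipschitzE (L : R) (A : H -> H) : L.-lipschitz A ->
  forall x y, `|A x - A y| <= L * `|x - y|.
Proof. by move=> A_lip x y; exact: (A_lip (x, y)). Qed.

(** Demicontractivity rewritten as an inequality affine in the fixed point p:
    the terms |p|^2 of both sides cancel. *)
Lemma demicontractive_dot (lambda : R) (T : H -> H) : demicontractive lambda T ->
  forall x p, Fix T p ->
  (1 - lambda) / 2 * `|x - T x| ^+ 2 <= dot (x - T x) (x - p).
Proof.
move=> [_ Tdemi] x p Fp; have := Tdemi x p Fp.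
rewrite (_ : T x - p = (x - p) - (x - T x)); last by rewrite opprB [RHS]addrC addrA subrK.
by rewrite (normB2 dot_norm) (dotC dot (x - p)); lra.
Qed.

(** A point p in all these half-spaces is fixed: take x = p. *)
Lemma Fix_halfspaces (lambda : R) (T : H -> H) : demicontractive lambda T ->
  Fix T = [set p | forall x, setT x -> dot (x - T x) p <=
                     dot (x - T x) x - (1 - lambda) / 2 * `|x - T x| ^+ 2].
Proof.
move=> Tdemi; apply/seteqP; split => p.
  by move=> Fp x _; have := demicontractive_dot Tdemi x Fp; rewrite dotDr dotNr; lra.
move=> /(_ p I) pp; have [/andP[_ l1] _] := Tdemi.
have : `|p - T p| ^+ 2 <= 0.
  by rewrite -(pmulr_rle0 _ (_ : 0 < (1 - lambda) / 2)); lra.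
rewrite real_exprn_even_le0 ?num_real//= normr_eq0 subr_eq0 => /eqP pT.
by rewrite /Fix /= -pT.
Qed.

(** Minty's lemma. Monotonicity exchanges A p for A q in one direction; in the
    other, test at q' = p + t (q - p) and let t tend to 0, A being continuous. *)
Lemma VI_Minty (C : set H) (A : H -> H) (L : R) :
  convex_set (C : set (convex_lmodType H)) -> monotone_op dot A ->
  L.-lipschitz A ->
  VI dot C A = C `&` [set p | forall q, C q -> dot (A q) p <= dot (A q) q].
Proof.
move=> /convex_set_segmentP Ccv Amono /lipschitzE Alip.
apply/seteqP; split => p [Cp pP]; split => // q Cq.
  by have := pP q Cq; have := Amono q p; rewrite dotDl dotNl (dotDr dot (A q)) dotNr; lra.
apply: (@ge0_of_small _ _ (L * `|q - p| ^+ 2)) => t /andP[t0 t1].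
have := pP _ (Ccv p q t Cp Cq _); rewrite ltW//= => /(_ t1).
set r := p + t *: (q - p); rewrite -subr_le0 -dotNr -dotDr.
have rp : r - p = t *: (q - p) by rewrite /r [p + _]addrC addrK.
rewrite -[p - r]opprB rp dotNr dotZr oppr_le0 pmulr_rge0// => Ar.
have := CauchySchwarz dot_norm (A r - A p) (q - p).
have : `|A r - A p| <= L * (t * `|q - p|).
  by rewrite (le_trans (Alip _ _))// rp normrZ gtr0_norm.
move=> /(ler_wpM2r (normr_ge0 (q - p))) Arp; rewrite dotDl dotNl.
by rewrite ler_norml => /andP[_]; lra.
Qed.

Lemma closed_convex_solutions (C : set H) (A T : H -> H) (L lambda : R) :
  closed C -> convex_set (C : set (convex_lmodType H)) ->
  monotone_op dot A -> L.-lipschitz A -> demicontractive lambda T ->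
  closed (Fix T `&` VI dot C A) /\
  convex_set (Fix T `&` VI dot C A : set (convex_lmodType H)).
Proof.
move=> Ccl Ccv Amono Alip Tdemi.
rewrite (Fix_halfspaces Tdemi) (VI_Minty Ccv Amono Alip); split.
  by apply: closedI; [|apply: closedI => //]; exact: closed_halfspaces.
apply/convex_set_segmentP => x y t [Fx [Cx Vx]] [Fy [Cy Vy]] t01.
have halfspaces := fun I P h c => (convex_set_segmentP _).1
  (@convex_halfspaces R H dot I P h c).
split; last split.
- exact: halfspaces t01.
- exact: (convex_set_segmentP C).1.
- exact: halfspaces t01.
Qed.

(** The second inequality is the obtuse angle criterion for the projection of
    the origin onto S. *)
Lemma min_norm_point_exists (S : set H) :
  S !=set0 -> closed S -> convex_set (S : set (convex_lmodType H)) ->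
  exists2 u, S u & forall p, S p -> `|u| <= `|p| /\ dot u (u - p) <= 0.
Proof.
move=> S0 Scl Scv; have [u Su uP] := nearest_point_exists dot_norm 0 S0 Scl Scv.
exists u => // p Sp; have := uP p Sp.
rewrite sub0r dotNl dotDr dotNr -dot_norm oppr_le0 subr_ge0 => up.
split; last by rewrite dotDr dotNr -dot_norm subr_le0.
have [->//|u0] := eqVneq u 0; first by rewrite normr0.
have un : 0 < `|u| by rewrite normr_gt0.
rewrite -(ler_pM2l un) -expr2; exact: le_trans up (dot_le dot_norm _ _).
Qed.

End SolutionSet.

Section OneStep.
Variables (R : realType) (H : completeNormedModType R).
Variable dot : {dot H for idfun}.
Hypothesis dot_norm : forall h : H, `|h| ^+ 2 = dot h h.

(** Expand |y - p|^2 around s. The projection inequality trades <s - y, y - p>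
    for gamma <A s, y - p>; the correction term of the step turns A s into A y,
    and <A y, y - p> >= <A p, y - p> >= 0 by monotonicity. *)
Lemma Tseng_step (C : set H) (A : H -> H) (p s y : H) (gamma : R) :
  monotone_op dot A -> VI dot C A p -> 0 <= gamma -> C y ->
  dot (s - gamma *: A s - y) (p - y) <= 0 ->
  `|y - gamma *: (A y - A s) - p| ^+ 2 <=
    `|s - p| ^+ 2 - `|s - y| ^+ 2 + gamma ^+ 2 * `|A y - A s| ^+ 2.
Proof.
move=> Amono [Cp pV] g0 Cy proj.
have : 0 <= gamma * dot (A y) (y - p).
  rewrite mulr_ge0//; have := pV y Cy; have := Amono y p.
  by rewrite dotDl dotNl; lra.
move: proj; rewrite !dot_norm !dotE !(dotC dot _ y) !(dotC dot _ p) !(dotC dot _ s).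
rewrite !(dotC dot (A s) (A y)); nra.
Qed.

(** The factor of |z - T z|^2 coming from expanding the square is
    eta (eta - (1 - lambda) (1 - beta)), and
    eta - (1 - lambda) (1 - beta) = eta (lambda + (1 - lambda) theta)
    - (1 - lambda) theta <= - eta lambda theta by the bound on eta. *)
Lemma demicontractive_step (T : H -> H) (lambda theta eta beta : R) (p z : H) :
  demicontractive lambda T -> Fix T p -> 0 < theta < 1 -> 0 < eta ->
  eta * (lambda + theta) <= (1 - lambda) * theta ->
  beta = (1 - eta) * (1 - theta) ->
  `|(1 - beta) *: (z - p) - eta *: (z - T z)| ^+ 2 <=
    (1 - beta) ^+ 2 * `|z - p| ^+ 2
    - eta ^+ 2 * lambda * theta * `|z - T z| ^+ 2.
Proof.
move=> Tdemi Fp /andP[th0 th1] e0 eta_le ->.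
have [/andP[l0 l1] _] := Tdemi.
have := demicontractive_dot dot_norm Tdemi z Fp.
rewrite (normB2 dot_norm (_ *: _)) !normrZ !exprMn !real_normK ?num_real//.
rewrite dotZl dotZr (dotC dot (z - p)).
have := sqr_ge0 `|z - T z|; set E := `|z - T z| ^+ 2; set d := dot _ _ => E0 dE.
have eta1 : eta <= 1.
  rewrite -(ler_pM2r (_ : 0 < lambda + theta)); last lra.
  by apply: le_trans eta_le _; nra.
set b := 1 - _.
have b0 : 0 <= eta * b by rewrite mulr_ge0 ?ltW// /b; nra.
have {}dE := ler_wpM2l b0 dE.
suff : eta * (eta - (1 - lambda) * b) * E <= - (eta ^+ 2 * lambda * theta) * E by lra.
apply: ler_wpM2r => //.
rewrite (_ : - (eta ^+ 2 * lambda * theta) =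
  eta * (- (eta * lambda * theta))); last by ring.
by rewrite ler_pM2l// /b; nra.
Qed.

End OneStep.

(** * Step sizes and weak limits of the iteration *)

Section StepSize.
Variable R : realType.

(** The step sizes are nonincreasing and, by the Lipschitz bound, at least
    min (gamma1, phi / L), so they converge to a positive limit. The rule bounds
    gamma_(k+1) D_k by phi S_k; as gamma_k / gamma_(k+1) tends to 1, any factor
    psi in ]phi, 1[ bounds gamma_k D_k eventually. *)
Lemma adaptive_stepsize (L phi gamma1 : R) (S D gamma : nat -> R) :
  0 < L -> 0 < gamma1 -> 0 < phi < 1 -> gamma 1%N = gamma1 ->
  (forall k, 0 <= D k <= L * S k) ->
  (forall k, (1 <= k)%N -> gamma k.+1 =
     if D k != 0 then Num.min (phi * S k / D k) (gamma k) else gamma k) ->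
  (exists2 g, 0 < g & forall k, (1 <= k)%N -> g <= gamma k <= gamma1) /\
  exists2 psi, 0 < psi < 1 & \forall k \near \oo, gamma k * D k <= psi * S k.
Proof.
move=> L0 g10 /andP[phi0 phi1] gamma_1 D_bd gammaE.
have S0 k : 0 <= S k.
  by have /andP[D0 DS] := D_bd k; rewrite -(pmulr_rge0 _ L0) (le_trans D0).
have mono k : (1 <= k)%N -> gamma k.+1 <= gamma k.
  by move=> k1; rewrite gammaE//; case: ifP => // _; rewrite ge_min lexx orbT.
have ctrl k : (1 <= k)%N -> gamma k.+1 * D k <= phi * S k.
  move=> k1; have /andP[D0 _] := D_bd k.
  have [->|Dn0] := eqVneq (D k) 0; first by rewrite mulr0 mulr_ge0// ltW.
  by rewrite -ler_pdivlMr ?lt_neqAle ?D0 1?eq_sym ?Dn0// gammaE// Dn0 ge_min lexx.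
pose g := Num.min gamma1 (phi / L).
have g0 : 0 < g by rewrite lt_min g10 divr_gt0.
have lb k : (1 <= k)%N -> g <= gamma k.
  elim: k => // -[_ _|k IH _]; first by rewrite gamma_1 ge_min lexx.
  rewrite gammaE//; case: ifP => [Dn0|_]; last exact: IH.
  have /andP[D0 DS] := D_bd k.+1.
  rewrite le_min IH// andbT ler_pdivlMr ?lt_neqAle 1?eq_sym ?Dn0//.
  apply: (@le_trans _ _ (phi / L * D k.+1)).
    by rewrite ler_wpM2r// ge_min lexx orbT.
  by rewrite mulrAC ler_pdivrMr// -mulrA ler_pM2l// mulrC.
have ub k : (1 <= k)%N -> gamma k <= gamma1.
  elim: k => // -[_ _|k IH _]; first by rewrite gamma_1.
  by apply: le_trans (mono _ _) (IH _).
split; first by exists g => // k k1; rewrite lb// ub.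
exists ((1 + phi) / 2); first by apply/andP; split; lra.
have gcvg : cvgn (fun n => gamma n.+1).
  apply: nonincreasing_is_cvgn; first by apply/nonincreasing_seqP => n; exact: mono.
  by exists g => _ [n _ <-]; exact: lb.
(* Two consecutive step sizes then differ by at most (1 - phi) / 2 * g, which
   is what phi gamma_k <= (1 + phi) / 2 * gamma_(k+1) requires. *)
have e0 : 0 < (1 - phi) / 4 * g by rewrite mulr_gt0//; lra.
have /cvgrPdist_le/(_ _ e0)[N _ gN] := gcvg.
exists N.+1 => // -[//|k] /= Nk.
have := gN k Nk; have := gN k.+1 (leqW Nk).
set l := lim _; rewrite !ler_norml => /andP[_ gk2] /andP[gk1 _].
have psi_gk : phi * gamma k.+1 <= (1 + phi) / 2 * gamma k.+2 by have := lb k.+2 isT; nra.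
have gk0 : 0 < gamma k.+2 := lt_le_trans g0 (lb k.+2 isT).
rewrite -(ler_pM2l gk0) mulrCA.
have gk0' : 0 <= gamma k.+1 := ltW (lt_le_trans g0 (lb k.+1 isT)).
apply: (le_trans (ler_wpM2l gk0' (ctrl k.+1 isT))).
rewrite mulrA [gamma _ * phi]mulrC mulrA [gamma _ * _]mulrC.
exact: ler_wpM2r.
Qed.

End StepSize.

Section WeakLimits.
Variables (R : realType) (H : completeNormedModType R).
Variable dot : {dot H for idfun}.
Hypothesis dot_norm : forall h : H, `|h| ^+ 2 = dot h h.

Lemma cvg0_of_norm2_le (v : nat -> H) (c : R) : 0 < c ->
  (forall n, c * `|v n| ^+ 2 <= n.+1%:R^-1) -> v @ \oo --> (0 : H).
Proof.
move=> c0 vc; apply/cvgrPdist_le => e e0.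
have ce : 0 < c * e ^+ 2 by rewrite mulr_gt0// exprn_gt0.
have := near_infty_natSinv_lt (PosNum ce); apply: filterS => n /= ne.
rewrite sub0r normrN -ler_sqr ?nnegrE ?(ltW e0)// -(ler_pM2l c0).
by rewrite (le_trans (vc n))// ltW.
Qed.

Lemma weak_cvg_dist0 (v v' : nat -> H) (w : H) :
  weak_cvg dot v w -> v n - v' n @[n --> \oo] --> (0 : H) ->
  weak_cvg dot v' w.
Proof.
move=> vw vv h.
have -> : (fun n => dot (v' n) h) = (fun n => dot (v n) h - dot h (v n - v' n)).
  by apply/funext => n; rewrite dotDr dotNr !(dotC dot h); ring.
rewrite -[X in _ --> X]subr0 -(dot0r dot h).
by apply: cvgB; [exact: vw|exact: (dot_cvgr dot_norm)].
Qed.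

(** For q in C, monotonicity and the projection inequality give
    <A q, q - y_n> >= - (1 / g + L) |s_n - y_n| |q - y_n|. In the limit
    <A q, q - w> >= 0, and Minty's lemma concludes. *)
Lemma weak_limit_VI (C : set H) (A : H -> H) (L g M : R)
    (s y : nat -> H) (gamma : nat -> R) (w : H) :
  closed C -> convex_set (C : set (convex_lmodType H)) ->
  0 < L -> monotone_op dot A -> L.-lipschitz A ->
  0 < g -> (forall n, g <= gamma n) ->
  (forall n, C (y n)) -> (forall n, `|y n| <= M) ->
  (forall n q, C q -> dot (s n - gamma n *: A (s n) - y n) (q - y n) <= 0) ->
  s n - y n @[n --> \oo] --> (0 : H) -> weak_cvg dot y w -> VI dot C A w.
Proof.
move=> Ccl Ccv L0 Amono Alip g0 g_le Cy yM proj sy yw.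
rewrite (VI_Minty dot_norm Ccv Amono Alip); split.
  exact: (weak_cvg_closed_convex dot_norm Ccl Ccv Cy yw).
move=> q Cq; pose K := (g^-1 + L) * (`|q| + M).
have lim : dot (A q) q - dot (y n) (A q) + K * `|s n - y n| @[n --> \oo]
    --> dot (A q) q - dot w (A q) + K * `|0 : H|.
  apply: cvgD; first by apply: cvgB; [exact: cvg_cst|exact: yw].
  by apply: cvgMl_tmp; exact: cvg_norm.
suff : 0 <= dot (A q) q - dot w (A q) + K * `|0 : H|.
  by rewrite normr0 mulr0 addr0 subr_ge0 dotC.
apply: (cvgr_to_ge lim); near=> n.
rewrite (dotC dot (y n)) -dotNr -dotDr.
have gn : 0 < gamma n := lt_le_trans g0 (g_le n).
have mono := Amono q (y n); rewrite dotDl dotNl subr_ge0 in mono.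
have qy : `|q - y n| <= `|q| + M by rewrite (le_trans (ler_normB _ _))// lerD2l.
have P0 : 0 <= `|s n - y n| * (`|q| + M).
  by rewrite mulr_ge0// (le_trans _ qy).
have sy1 : - (`|s n - y n| * (`|q| + M)) <= dot (s n - y n) (q - y n).
  have := CauchySchwarz dot_norm (s n - y n) (q - y n).
  move=> /le_trans/(_ (ler_wpM2l (normr_ge0 _) qy)).
  by rewrite ler_norml => /andP[].
have sy2 : dot (A (s n) - A (y n)) (q - y n) <= L * (`|s n - y n| * (`|q| + M)).
  apply: (le_trans (dot_le dot_norm _ _)); rewrite mulrA.
  by apply: ler_pM => //; exact: lipschitzE.
have := proj n q Cq; rewrite addrAC dotDl dotNl dotZl.
rewrite dotDl dotNl in sy2 => pr.
rewrite -(pmulr_rge0 _ gn) /K.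
move: (dot (A q) _) (dot (A (y n)) _) (dot (A (s n)) _) (dot (s n - _) _) mono sy1 sy2 pr.
rewrite -!mulrA (mulrC (`|q| + M)).
move: (_ * (`|q| + M)) P0 => P P0 X Y Z V mono sy1 sy2 pr.
have gg : 1 <= gamma n * g^-1 by rewrite ler_pdivlMr// mul1r.
have : P <= gamma n * g^-1 * P by rewrite ler_peMl.
have := ler_wpM2l (ltW gn) mono; have := ler_wpM2l (ltW gn) sy2; lra.
Unshelve. all: by end_near. Qed.

End WeakLimits.

(** * Convergence of the iterates *)

Section Algorithm.
Variables (R : realType) (H : completeNormedModType R).
Variable dot : {dot H for idfun}.
Hypothesis dot_norm : forall h : H, `|h| ^+ 2 = dot h h.
Variable C : set H.
Hypothesis C_nonempty : C !=set0.
Hypothesis C_closed : closed C.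
Hypothesis C_convex : convex_set (C : set (convex_lmodType H)).
Variables (A T : H -> H) (L lambda : R).
Hypothesis L_gt0 : 0 < L.
Hypothesis A_mono : monotone_op dot A.
Hypothesis A_lip : L.-lipschitz A.
Hypothesis T_demi : demicontractive lambda T.
Hypothesis T_demiclosed : demiclosed_id_sub dot T.
Hypothesis lambda_gt0 : 0 < lambda.
Variables (theta zeta eta : nat -> R) (a : R).
Hypothesis theta_itv : forall k, (1 <= k)%N -> 0 < theta k < 1.
Hypothesis theta_lim : 1 - theta k @[k --> \oo] --> (0 : R).
Hypothesis theta_sum : (\sum_(1 <= k <oo) (1 - theta k)%:E = +oo)%E.
Hypothesis zeta_gt0 : forall k, (1 <= k)%N -> 0 < zeta k.
Hypothesis zeta_lim : zeta k / (1 - theta k) @[k --> \oo] --> (0 : R).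
Hypothesis a_gt0 : 0 < a.
Hypothesis eta_itv : forall k, (1 <= k)%N ->
  a < eta k < (1 - lambda) * theta k / (lambda + theta k).
Variables (x s y z : nat -> H) (gamma : nat -> R) (g psi : R).
Hypothesis s_near : forall k, (1 <= k)%N -> `|s k - x k| <= zeta k.
Hypothesis y_def : forall k, (1 <= k)%N ->
  y k = metric_proj C (s k - gamma k *: A (s k)).
Hypothesis z_def : forall k, (1 <= k)%N ->
  z k = y k - gamma k *: (A (y k) - A (s k)).
Hypothesis x_def : forall k, (1 <= k)%N ->
  x k.+1 = (1 - eta k) *: (theta k *: z k) + eta k *: T (z k).
Hypothesis g_gt0 : 0 < g.
Hypothesis gamma_ge : forall k, (1 <= k)%N -> g <= gamma k.
Hypothesis psi_itv : 0 < psi < 1.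
Hypothesis gamma_psi :
  \forall k \near \oo, gamma k * `|A (s k) - A (y k)| <= psi * `|s k - y k|.

Let alpha k := 1 - theta k.
Let beta k := (1 - eta k) * alpha k.
(** Half of the coefficient of |s_k - y_k|^2 in Tseng's estimate; the other half
    pays for the factor 1 - beta_k >= 1 / 2. *)
Let c := (1 - psi ^+ 2) / 2.
Let damping k := c * `|s k - y k| ^+ 2
  + a ^+ 2 * lambda / 2 * `|z k - T (z k)| ^+ 2.

Let alpha_itv k : (1 <= k)%N -> 0 < alpha k < 1.
Proof. by move=> k1; have := theta_itv k1; rewrite /alpha; lra. Qed.

Let eta_gt0 k : (1 <= k)%N -> 0 < eta k.
Proof. by move=> /eta_itv /andP[ak _]; exact: lt_trans ak. Qed.

Let eta_le k : (1 <= k)%N ->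
  eta k * (lambda + theta k) <= (1 - lambda) * theta k.
Proof.
move=> k1; have /andP[t0 _] := theta_itv k1; have /andP[_ /ltW] := eta_itv k1.
by rewrite ler_pdivlMr// addr_gt0.
Qed.

Let beta_itv k : (1 <= k)%N -> lambda * alpha k <= beta k <= alpha k.
Proof.
move=> k1; have /andP[t0 t1] := theta_itv k1; have := eta_le k1.
have := eta_gt0 k1 => e0 el; have /andP[a0 _] := alpha_itv k1.
have [/andP[_ l1] _] := T_demi.
rewrite /beta ler_pM2r//; apply/andP; split; last first.
  by rewrite -[leRHS]mul1r ler_pM2r//; lra.
have lt0 : 0 < lambda + theta k by rewrite addr_gt0.
suff : eta k <= 1 - lambda by lra.
rewrite -(ler_pM2r lt0); apply: le_trans el _.
by rewrite ler_wpM2l ?lerDr ?(ltW lambda_gt0)//; lra.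
Qed.

Let psi2_lt1 : 0 < psi ^+ 2 < 1.
Proof. by have /andP[p0 p1] := psi_itv; rewrite exprn_gt0// expr_lt1// ltW. Qed.

Let c_gt0 : 0 < c.
Proof. by have := psi2_lt1; rewrite /c; lra. Qed.

Let damping_ge0 k : 0 <= damping k.
Proof.
by rewrite /damping addr_ge0// mulr_ge0 ?sqr_ge0// ?(ltW c_gt0)//
  divr_ge0// mulr_ge0 ?sqr_ge0// ltW.
Qed.

Let y_proj k : (1 <= k)%N -> C (y k) /\
  forall q, C q -> dot (s k - gamma k *: A (s k) - y k) (q - y k) <= 0.
Proof. by move=> k1; rewrite y_def//; exact: metric_projP. Qed.

Let gamma_ge0 k : (1 <= k)%N -> 0 <= gamma k.
Proof. by move=> k1; rewrite ltW// (lt_le_trans g_gt0)// gamma_ge. Qed.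

(** Gathers the eventual conditions, so that the one-step estimates are free
    of limits. *)
Let settled k := [/\ (1 <= k)%N, alpha k <= 1 / 2, zeta k <= alpha k &
  gamma k * `|A (s k) - A (y k)| <= psi * `|s k - y k|].

Let settled_near : exists2 N, (1 <= N)%N & forall k, (N <= k)%N -> settled k.
Proof.
have h0 : 0 < 1 / 2 :> R by lra.
have /cvgrPdist_le/(_ _ h0)[N1 _ th] := theta_lim.
have /cvgrPdist_le/(_ _ ltr01)[N2 _ ze] := zeta_lim.
have [N3 _ ga] := gamma_psi.
exists (maxn 1 (maxn N1 (maxn N2 N3))); first by rewrite leq_max leqnn.
move=> k; rewrite !geq_max => /and4P[k1 kN1 kN2 kN3].
have /andP[a0 _] := alpha_itv k1.
split=> //; last exact: ga.
- have := th k kN1; rewrite /= sub0r normrN; exact: le_trans (ler_norm _).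
- have := ze k kN2; rewrite /= sub0r normrN => /(le_trans (ler_norm _)).
  by rewrite ler_pdivrMr// mul1r.
Qed.

Let s_dist k p : (1 <= k)%N -> `|s k - p| <= `|x k - p| + zeta k.
Proof.
move=> k1; rewrite -(subrK (x k) (s k)) -addrA addrC.
by rewrite (le_trans (ler_normD _ _))// lerD2l s_near.
Qed.

Let z_dist2 k p : VI dot C A p -> settled k ->
  `|z k - p| ^+ 2 <= `|s k - p| ^+ 2 - 2 * c * `|s k - y k| ^+ 2.
Proof.
move=> Vp [k1 _ _ gk]; have [Cy yP] := y_proj k1.
rewrite z_def//.
apply: (le_trans (Tseng_step dot_norm A_mono Vp (gamma_ge0 k1) Cy (yP _ Vp.1))).
rewrite -exprMn (distrC (A (y k))).
have : (gamma k * `|A (s k) - A (y k)|) ^+ 2 <= (psi * `|s k - y k|) ^+ 2.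
  rewrite ler_sqr ?nnegrE ?mulr_ge0 ?gamma_ge0//.
  by have /andP[/ltW] := psi_itv.
rewrite (exprMn _ psi) /c; lra.
Qed.

Let z_dist k p : VI dot C A p -> settled k -> `|z k - p| <= `|x k - p| + zeta k.
Proof.
move=> Vp sk; have [k1 _ _ _] := sk.
apply: le_trans (s_dist p k1); rewrite -ler_sqr ?nnegrE//.
apply: le_trans (z_dist2 Vp sk) _.
by rewrite gerBl mulr_ge0 ?sqr_ge0// mulr_ge0// ltW.
Qed.

(** The next iterate, relative to p, before its pull towards the origin. *)
Let relaxed k p := (1 - beta k) *: (z k - p) - eta k *: (z k - T (z k)).

Let x_next k p : (1 <= k)%N -> x k.+1 - p = relaxed k p - beta k *: p.
Proof.
move=> k1; apply: (eq_from_dot dot_norm) => h.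
by rewrite x_def// /relaxed !dotE /beta /alpha; ring.
Qed.

Let relaxed2 k p : Fix T p -> settled k ->
  `|relaxed k p| ^+ 2 <= (1 - beta k) ^+ 2 * `|z k - p| ^+ 2
    - a ^+ 2 * lambda / 2 * `|z k - T (z k)| ^+ 2.
Proof.
move=> Fp [k1 ak _ _].
apply: (le_trans (demicontractive_step dot_norm (z k) T_demi Fp (theta_itv k1)
  (eta_gt0 k1) (eta_le k1) erefl)).
rewrite lerD2l lerN2 ler_wpM2r ?sqr_ge0//.
have /andP[/ltW ae _] := eta_itv k1.
have : a ^+ 2 <= eta k ^+ 2 by rewrite ler_sqr ?nnegrE// ltW// ?eta_gt0.
move=> /(ler_wpM2r (ltW lambda_gt0)) le1.
have el0 : 0 <= eta k ^+ 2 * lambda by rewrite mulr_ge0 ?sqr_ge0// ltW.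
have : 1 / 2 <= theta k by move: ak; rewrite /alpha; lra.
by move=> /(ler_wpM2l el0); lra.
Qed.

Let betaE k : settled k -> [/\ 0 <= beta k, beta k <= 1 / 2,
  0 <= zeta k <= 1, beta k <= alpha k &
  zeta k <= beta k * ((zeta k / alpha k) / lambda)].
Proof.
move=> [k1 a2 za _]; have /andP[lb ub] := beta_itv k1.
have /andP[a0 a1] := alpha_itv k1; have z0 := zeta_gt0 k1.
have la0 : 0 < lambda * alpha k by rewrite mulr_gt0.
split; rewrite ?(ltW z0) //=; try lra.
have -> : zeta k / alpha k / lambda = zeta k / (lambda * alpha k).
  by rewrite invfM mulrA mulrAC.
by rewrite mulrCA ler_peMr ?(ltW z0)// ler_pdivlMr// mul1r.
Qed.

(** |x_{k+1} - p| is at most a convex combination, with weights 1 - beta_k and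
    beta_k, of |x_k - p| and |p| + 1 / lambda; the term 1 / lambda comes from the
    inertial error zeta_k <= alpha_k <= beta_k / lambda. *)
Let bounded p : (Fix T `&` VI dot C A) p ->
  exists2 M, 0 <= M & \forall k \near \oo, `|x k - p| <= M.
Proof.
move=> [Fp Vp]; have [N N1 Nset] := settled_near.
pose B := `|p| + lambda^-1.
have B0 : 0 <= B by rewrite addr_ge0// invr_ge0 ltW.
exists (Num.max `|x N - p| B); first by rewrite le_max B0 orbT.
exists N => //; elim=> [|k IH] /=; first by rewrite leqn0 => /eqP->; rewrite le_max lexx.
rewrite leq_eqVlt => /orP[/eqP->|]; first by rewrite le_max lexx.
rewrite ltnS => Nk; have {}IH := IH Nk; have sk := Nset k Nk.
have [k1 _ za _] := sk; have [b0 b2 /andP[z0 _] _ zb] := betaE sk.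
rewrite x_next// (le_trans (ler_normB _ _))// normrZ (ger0_norm b0).
have rz : `|relaxed k p| <= (1 - beta k) * `|z k - p|.
  have b1 : 0 <= 1 - beta k by lra.
  rewrite -ler_sqr ?nnegrE ?mulr_ge0// exprMn.
  apply: le_trans (relaxed2 Fp sk) _; rewrite gerBl mulr_ge0 ?sqr_ge0//.
  by rewrite divr_ge0// mulr_ge0 ?sqr_ge0// ltW.
have zx := z_dist Vp sk.
have zal : zeta k / alpha k <= 1.
  by have /andP[a0 _] := alpha_itv k1; rewrite ler_pdivrMr// mul1r.
have zbl : zeta k <= beta k * lambda^-1.
  apply: (le_trans zb); rewrite ler_wpM2l//.
  by rewrite -[leRHS]mul1r ler_wpM2r// invr_ge0 ltW.
move: IH; set M := Num.max _ _ => IH.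
have BM : B <= M by rewrite /M le_max lexx orbT.
have b1 : 0 <= 1 - beta k by lra.
have := ler_wpM2l b1 (le_trans zx (lerD IH (lexx (zeta k)))).
have := ler_wpM2l b0 BM; rewrite /B => h1 h2.
have := mulr_ge0 b0 z0; lra.
Qed.

Let perturbation (M : R) (u : H) k :=
  2 * dot u (u - x k.+1) + (2 * M + 1) / lambda * (zeta k / (1 - theta k)).

(** Expanding |relaxed_k|^2 = |(x_{k+1} - p) + beta_k p|^2 produces the inner
    product in the perturbation; the rest combines the two one-step estimates. *)
Let energy_recursion p M k : (Fix T `&` VI dot C A) p -> settled k ->
  `|x k - p| <= M ->
  `|x k.+1 - p| ^+ 2 <= (1 - beta k) * `|x k - p| ^+ 2
    + beta k * perturbation M p k - damping k.
Proof.
move=> [Fp Vp] sk xM; have [k1 _ _ _] := sk.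
have [b0 b2 /andP[z0 z1] _ zb] := betaE sk.
have step1 : `|x k.+1 - p| ^+ 2 <=
    `|relaxed k p| ^+ 2 + 2 * beta k * dot p (p - x k.+1).
  have -> : relaxed k p = (x k.+1 - p) + beta k *: p by rewrite x_next// subrK.
  rewrite (normD2 dot_norm (_ - _) (_ *: _)) dotZr -(opprB (x _) p) dotNr (dotC dot p).
  by have := sqr_ge0 `|beta k *: p|; lra.
have step2 := relaxed2 Fp sk.
have step3 := z_dist2 Vp sk.
have step4 : `|s k - p| ^+ 2 <= `|x k - p| ^+ 2 + (2 * M + 1) * zeta k.
  have := s_dist p k1; rewrite -ler_sqr ?nnegrE ?addr_ge0// => h.
  apply: (le_trans h); have := normr_ge0 (x k - p); nra.
have M0 : 0 <= 2 * M + 1 by have := le_trans (normr_ge0 _) xM; lra.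
have step5 := ler_wpM2l M0 zb.
have b1 : 0 <= 1 - beta k by lra.
have step6 : (1 - beta k) ^+ 2 * `|z k - p| ^+ 2 <= (1 - beta k) * `|z k - p| ^+ 2.
  by rewrite ler_wpM2r ?sqr_ge0// expr2 ler_piMl//; lra.
have step7 := ler_wpM2l b1 step3.
have step8 := ler_wpM2l b1 step4.
have ce : 0 <= c * `|s k - y k| ^+ 2 by rewrite mulr_ge0 ?sqr_ge0// ltW.
have step9 := ler_wpM2r ce b2.
have step10 := mulr_ge0 b0 (mulr_ge0 M0 z0).
rewrite /perturbation /damping -/(alpha k); lra.
Qed.

(** Vanishing damping makes s - y, z - T z and, through the bound on
    gamma_k |A s_k - A y_k|, z - y tend to 0, so y and z have the same weak
    limit. So has the next iterate, as beta_k tends to 0. *)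
Let weak_cluster_point (M : R) (i : nat -> nat) :
  (forall n, (n <= i n)%N) -> (forall n, settled (i n)) ->
  (forall n, `|z (i n)| <= M) ->
  (forall n, damping (i n) <= n.+1%:R^-1) ->
  exists j w, [/\ forall n, (n <= j n)%N, (Fix T `&` VI dot C A) w &
    weak_cvg dot (fun n => x (i (j n)).+1) w].
Proof.
move=> i_ge i_set zM i_damp.
have [j [w [j_ge zw]]] := bounded_weakly_cvg_subsequence dot_norm zM.
have dampj n : damping (i (j n)) <= n.+1%:R^-1.
  by apply: le_trans (i_damp (j n)) _; rewrite lef_pV2 ?posrE// ler_nat ltnS.
have i1 n : (1 <= i (j n))%N by have [] := i_set (j n).
have al0 : 0 < a ^+ 2 * lambda / 2 by rewrite divr_gt0// mulr_gt0// exprn_gt0.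
have sy0 : s (i (j n)) - y (i (j n)) @[n --> \oo] --> (0 : H).
  apply: (cvg0_of_norm2_le c_gt0) => n; apply: le_trans (dampj n).
  by rewrite /damping lerDl mulr_ge0 ?sqr_ge0// ltW.
have zT0 : z (i (j n)) - T (z (i (j n))) @[n --> \oo] --> (0 : H).
  apply: (cvg0_of_norm2_le al0) => n; apply: le_trans (dampj n).
  by rewrite /damping lerDr mulr_ge0 ?sqr_ge0// ltW.
have zy n : `|z (i (j n)) - y (i (j n))| <= psi * `|s (i (j n)) - y (i (j n))|.
  have [k1 _ _ gk] := i_set (j n).
  by rewrite z_def// [y _ - _]addrC addrK normrN normrZ distrC ger0_norm ?gamma_ge0.
have zy0 : z (i (j n)) - y (i (j n)) @[n --> \oo] --> (0 : H).
  apply/norm_cvg0P; apply: (@squeeze_cvgr _ _ _ _ (cst 0)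
    (fun n => psi * `|s (i (j n)) - y (i (j n))|)).
  - by near=> n; rewrite zy normr_ge0.
  - exact: cvg_cst.
  - by rewrite -(mulr0 psi) -(normr0 H); apply: cvgMl_tmp; exact: cvg_norm.
have yw : weak_cvg dot (fun n => y (i (j n))) w.
  exact: (weak_cvg_dist0 dot_norm zw zy0).
have [My yM] : exists My, forall n, `|y (i (j n))| <= My.
  have /cvg_seq_bounded : cvgn (fun n => z (i (j n)) - y (i (j n))).
    by apply/cvg_ex; exists 0.
  case=> B [_ /(_ (B + 1))]; rewrite ltrDl ltr01 => /(_ isT) BB.
  exists (M + (B + 1)) => n; rewrite -(subrK (z (i (j n))) (y _)) addrC.
  rewrite (le_trans (ler_normD _ _))// lerD//.
  by rewrite distrC; exact: BB.
exists j, w; split=> //.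
  split; first exact: T_demiclosed zw zT0.
  apply: (weak_limit_VI dot_norm (s := fun n => s (i (j n)))
    (gamma := fun n => gamma (i (j n))) C_closed C_convex L_gt0 A_mono A_lip g_gt0
    _ _ yM _ sy0 yw).
  - by move=> n; exact: gamma_ge.
  - by move=> n; have [] := y_proj (i1 n).
  - by move=> n; have [] := y_proj (i1 n).
apply: (weak_cvg_dist0 dot_norm zw); apply/norm_cvg0P.
pose bd n := alpha (i (j n)) * M + `|z (i (j n)) - T (z (i (j n)))|.
apply: (@squeeze_cvgr _ _ _ _ (cst 0) bd).
- near=> n; rewrite normr_ge0 /=.
  have [b0 b2 _ ba _] := betaE (i_set (j n)).
  have -> : z (i (j n)) - x (i (j n)).+1 = beta (i (j n)) *: z (i (j n))
      + eta (i (j n)) *: (z (i (j n)) - T (z (i (j n)))).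
    rewrite -[x _]subr0 x_next// /relaxed subr0 scaler0 subr0 scalerBl scale1r.
    by rewrite !opprB addrA addrC addrA subrK addrC.
  rewrite (le_trans (ler_normD _ _))// /bd.
  rewrite (normrZ (beta _)) (normrZ (eta _)); apply: lerD.
    by rewrite (ger0_norm b0); apply: ler_pM.
  have /andP[e0 e1] : 0 <= eta (i (j n)) <= 1.
    rewrite ltW ?eta_gt0//=; have /andP[a0 _] := alpha_itv (i1 n).
    by rewrite -(ler_pM2r a0) mul1r; move: b0; rewrite /beta; lra.
  by rewrite ger0_norm// ler_piMl.
- exact: cvg_cst.
- rewrite /bd -[X in _ --> X]addr0 -[X in _ --> X + _](mul0r M).
  rewrite -[X in _ --> _ + X](normr0 H).
  apply: cvgD; last exact: cvg_norm.
  apply: cvgMr_tmp; apply: (cvg_comp (fun n => i (j n)) alpha); last exact: theta_lim.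
  apply/cvgnyPge => B; exists B => // n /= Bn.
  exact: leq_trans Bn (leq_trans (j_ge n) (i_ge _)).
Unshelve. all: by end_near. Qed.

(** Otherwise there would be indices with vanishing damping and perturbation
    above e; at a weak cluster point w of the iterates this gives
    2 <u, u - w> >= e > 0, although w is a solution. *)
Let perturbation_small (M e : R) u :
  (Fix T `&` VI dot C A) u ->
  (forall p, (Fix T `&` VI dot C A) p -> dot u (u - p) <= 0) ->
  0 < e ->
  exists2 d, 0 < d &
    \forall k \near \oo, damping k <= d -> perturbation M u k <= e.
Proof.
move=> Su u_min e0; apply: contrapT => no.
have [N N1 Nset] := settled_near.
have [B B0 [N' _ xB]] := bounded Su.
have /choice[i iP] : forall n, exists k, [/\ (maxn n (maxn N N') <= k)%N,
    damping k <= n.+1%:R^-1 & e < perturbation M u k].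
  move=> n; apply: contrapT => nok; apply: no.
  exists n.+1%:R^-1; first by rewrite invr_gt0.
  exists (maxn n (maxn N N')) => // k /= nk dk; rewrite leNgt; apply/negP => ek.
  by apply: nok; exists k.
have i_ge n : [/\ (n <= i n)%N, (N <= i n)%N & (N' <= i n)%N].
  by have [+ _ _] := iP n; rewrite !geq_max => /and3P[].
have i_set n : settled (i n) by have [_ /Nset] := i_ge n.
have zM n : `|z (i n)| <= B + 1 + `|u|.
  rewrite -(subrK u (z _)) (le_trans (ler_normD _ _))// lerD2r.
  have [_ _ /andP[_ z1] _ _] := betaE (i_set n).
  have [_ _ /xB xiB] := i_ge n.
  exact: le_trans (z_dist Su.2 (i_set n)) (lerD xiB z1).
have [||j [w [j_ge Sw xw]]] := weak_cluster_point _ i_set zM.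
- by move=> n; have [] := i_ge n.
- by move=> n; have [] := iP n.
have lim : 2 * (dot u u - dot (x (i (j n)).+1) u)
    + (2 * M + 1) / lambda * (zeta (i (j n)) / (1 - theta (i (j n)))) @[n --> \oo]
    --> 2 * (dot u u - dot w u) + (2 * M + 1) / lambda * 0.
  apply: cvgD; apply: cvgMl_tmp.
    by apply: cvgB; [exact: cvg_cst|exact: xw].
  apply: (cvg_comp (fun n => i (j n)) (fun k => zeta k / (1 - theta k))).
    2: exact: zeta_lim.
  apply/cvgnyPge => K; exists K => // n /= Kn.
  have [ge_i _ _] := i_ge (j n).
  exact: leq_trans Kn (leq_trans (j_ge n) ge_i).
have : e <= 2 * (dot u u - dot w u) + (2 * M + 1) / lambda * 0.
  apply: (cvgr_to_ge lim); near=> n.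
  have [_ _ /ltW] := iP (j n).
  by rewrite /perturbation dotDr dotNr (dotC dot u (x _)).
have := u_min w Sw; rewrite dotDr dotNr (dotC dot u w) mulr0 addr0; lra.
Unshelve. all: by end_near. Qed.

Theorem iterates_cvg_min_norm u :
  (Fix T `&` VI dot C A) u ->
  (forall p, (Fix T `&` VI dot C A) p -> dot u (u - p) <= 0) ->
  x @ \oo --> u.
Proof.
move=> Su u_min.
have [N N1 Nset] := settled_near.
have [M M0 [N' _ xM]] := bounded Su.
suff : (fun k => `|x k - u| ^+ 2) @ \oo --> (0 : R).
  move=> x2; apply/cvgrPdist_le => e e0.
  have e2 : 0 < e ^+ 2 by rewrite exprn_gt0.
  have /cvgrPdist_le/(_ _ e2) := x2; apply: filterS => k.
  rewrite sub0r normrN ger0_norm ?sqr_ge0// ler_sqr ?nnegrE// ?(ltW e0)//.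
  by rewrite distrC.
pose B := 2 * (`|u| * M) + `|(2 * M + 1) / lambda|.
apply: (@cvg_to0_of_damped_recursion R _ (perturbation M u) beta damping B (maxn N N')).
- move=> k; rewrite geq_max => /andP[/Nset sk N'k].
  have [k1 _ za _] := sk; have [b0 _ _ _ _] := betaE sk.
  split; [exact: sqr_ge0|exact: b0|exact: damping_ge0| |].
    2: exact: energy_recursion (xM k N'k).
  have /andP[a0 _] := alpha_itv k1.
  have za0 : 0 <= zeta k / alpha k by rewrite divr_ge0// ltW ?zeta_gt0.
  have za1 : zeta k / alpha k <= 1 by rewrite ler_pdivrMr// mul1r.
  rewrite /perturbation /B lerD//.
    rewrite ler_pM2l// (le_trans (dot_le dot_norm _ _))// ler_wpM2l//.
    by rewrite distrC xM//= leqW.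
  apply: (@le_trans _ _ (`|(2 * M + 1) / lambda| * (zeta k / alpha k))).
    by rewrite ler_wpM2r// ler_norm.
  by rewrite ler_piMr.
- apply: (@squeeze_cvgr _ _ _ _ (cst 0) alpha); last exact: theta_lim.
    by exists N => // k /Nset sk; have [-> _ _ -> _] := betaE sk.
  exact: cvg_cst.
- move=> K K' NK.
  have K1 : (1 <= K)%N by apply: leq_trans N1 (leq_trans (leq_maxl _ _) NK).
  have al0 k : (1 <= k)%N -> 0 <= alpha k by move=> /alpha_itv /andP[/ltW].
  have [n nK] := nneseries_unbounded al0 theta_sum (K' / lambda) K1.
  exists n; move: nK; rewrite ltr_pdivrMr// mulrC mulr_sumr => /lt_le_trans; apply.
  rewrite !big_nat; apply: ler_sum => k /andP[Kk _].
  by have /andP[] := beta_itv (leq_trans K1 Kk).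
- by move=> e; exact: perturbation_small.
Qed.

End Algorithm.

(** * Convergence to the solution of least norm *)

(** For lambda = 0 both intervals are ]a, 1[. *)
Lemma lambda_gt0_of_proper (R : realType) (lambda theta a : R) :
  0 <= lambda -> 0 < theta ->
  `]a, (1 - lambda) * theta / (lambda + theta)[%classic
    `<` `]a, (1 - lambda) / (1 + lambda)[%classic -> 0 < lambda.
Proof.
rewrite le_eqVlt => /orP[/eqP <-|//] t0.
by rewrite subr0 add0r addr0 divr1 mul1r divff ?gt_eqF// => -[_ []].
Qed.


(* In the chain of intervals, the inclusions are read as proper ones; for the
   non-strict reading the theorem fails at lambda = 0. *)
Theorem theorem4 (R : realType) (H : completeNormedModType R)
    (dot : {dot H for idfun}) (dot_norm : forall h : H, `|h| ^+ 2 = dot h h)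
    (C : set H) (C_nonempty : C !=set0) (C_closed : closed C)
    (C_convex : convex_set (C : set (convex_lmodType H)))
    (A T : H -> H)
    (L : R) (L_gt0 : 0 < L) (A_mono : monotone_op dot A)
    (A_lip : L.-lipschitz A)
    (lambda : R) (T_demi : demicontractive lambda T)
    (T_demiclosed : demiclosed_id_sub dot T)
    (sol_nonempty : Fix T `&` VI dot C A !=set0)
    (theta zeta eta : nat -> R)
    (theta_itv : forall k, (1 <= k)%N -> 0 < theta k < 1)
    (theta_lim : 1 - theta k @[k --> \oo] --> (0 : R))
    (theta_sum : (\sum_(1 <= k <oo) (1 - theta k)%:E = +oo)%E)
    (zeta_gt0 : forall k, (1 <= k)%N -> 0 < zeta k)
    (zeta_lim : zeta k / (1 - theta k) @[k --> \oo] --> (0 : R))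
    (a : R) (a_gt0 : 0 < a)
    (eta_itv : forall k, (1 <= k)%N ->
       [/\ a < eta k < (1 - lambda) * theta k / (lambda + theta k),
           `]a, (1 - lambda) * theta k / (lambda + theta k)[%classic
             `<` `]a, (1 - lambda) / (1 + lambda)[%classic
         & `]a, (1 - lambda) / (1 + lambda)[%classic
             `<` `]a, 1 - lambda[%classic])
    (delta gamma1 phi : R) (delta_gt0 : 0 < delta) (gamma1_gt0 : 0 < gamma1)
    (phi_itv : 0 < phi < 1)
    (x s y z : nat -> H) (deltak gamma : nat -> R)
    (gamma_init : gamma 1%N = gamma1)
    (deltak_def : forall k, (1 <= k)%N ->
       deltak k = if x k != x k.-1
                  then Num.min (zeta k / `|x k - x k.-1|) delta
                  else delta)
    (s_def : forall k, (1 <= k)%N -> s k = x k + deltak k *: (x k - x k.-1))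
    (y_def : forall k, (1 <= k)%N ->
       y k = metric_proj C (s k - gamma k *: A (s k)))
    (z_def : forall k, (1 <= k)%N ->
       z k = y k - gamma k *: (A (y k) - A (s k)))
    (x_def : forall k, (1 <= k)%N ->
       x k.+1 = (1 - eta k) *: (theta k *: z k) + eta k *: T (z k))
    (gamma_def : forall k, (1 <= k)%N ->
       gamma k.+1 = if A (s k) - A (y k) != 0
                    then Num.min (phi * `|s k - y k| / `|A (s k) - A (y k)|)
                                 (gamma k)
                    else gamma k) :
  exists u : H,
    [/\ (Fix T `&` VI dot C A) u,
        forall p, (Fix T `&` VI dot C A) p -> `|u| <= `|p|
      & x k @[k --> \oo] --> u].
Proof.
have lambda_gt0 : 0 < lambda.
  have [_ proper _] := eta_itv 1%N isT; have [/andP[l0 _] _] := T_demi.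
  by apply: lambda_gt0_of_proper l0 _ proper; have /andP[] := theta_itv 1%N isT.
have s_near k : (1 <= k)%N -> `|s k - x k| <= zeta k.
  move=> k1; rewrite s_def// [x k + _]addrC addrK normrZ deltak_def//.
  have zeta0 := zeta_gt0 k k1.
  have [->|xk] := eqVneq (x k) (x k.-1); first by rewrite subrr normr0 mulr0 ltW.
  have n0 : 0 < `|x k - x k.-1| by rewrite normr_gt0 subr_eq0.
  rewrite ger0_norm; last by rewrite le_min (ltW delta_gt0) divr_ge0// ltW.
  by rewrite -ler_pdivlMr// ge_min lexx.
have D_bd k : 0 <= `|A (s k) - A (y k)| <= L * `|s k - y k|.
  by rewrite normr_ge0 lipschitzE.
have gammaE k : (1 <= k)%N -> gamma k.+1 =
    if `|A (s k) - A (y k)| != 0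
    then Num.min (phi * `|s k - y k| / `|A (s k) - A (y k)|) (gamma k)
    else gamma k.
  by move=> k1; rewrite gamma_def// normr_eq0.
have [[g g0 g_le] [psi psi01 gamma_psi]] :=
  adaptive_stepsize L_gt0 gamma1_gt0 phi_itv gamma_init D_bd gammaE.
have [Scl Scv] :=
  closed_convex_solutions dot_norm C_closed C_convex A_mono A_lip T_demi.
have [u Su u_min] := min_norm_point_exists dot_norm sol_nonempty Scl Scv.
exists u; split => //; first by move=> p /u_min[].
apply: (iterates_cvg_min_norm dot_norm C_nonempty C_closed C_convex L_gt0 A_mono
  A_lip T_demi T_demiclosed lambda_gt0 theta_itv theta_lim theta_sum zeta_gt0
  zeta_lim a_gt0 _ s_near y_def z_def x_def g0 _ psi01 gamma_psi Su).
- by move=> k /eta_itv[].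
- by move=> k /g_le /andP[].
- by move=> p /u_min[].
Qed.
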